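(* For every integer $n\ge 3$, the power graph of the dihedral group $D_{2n}$ of order $2n$ satisfies $$\mathrm{sdim}(\Gamma_{D_{2n}})=2n-(\sigma_n+1).$$
   Context: The power graph $\Gamma_G$ of a finite group $G$ has vertex set $G$, and two distinct elements are adjacent if one is a power of the other. For vertices $x,y,z$ of a graph $\Gamma$, the vertex $z$ strongly resolves $x$ and $y$ if there exists a shortest path from $z$ to $x$ containing $y$, or a shortest path from $z$ to $y$ containing $x$. A subset $S$ of $V(\Gamma)$ is a strong resolving set if every pair of (distinct) vertices of $\Gamma$ is strongly resolved by some vertex of $S$. The strong metric dimension $\mathrm{sdim}(\Gamma)$ is the smallest cardinality of a strong resolving set of $\Gamma$. $D_{2n}=\langle a,b: a^n=b^2=1,\ bab=a^{-1}\rangle$. For $n=p_1^{r_1}\cdots p_m^{r_m}$ with distinct primes $p_i$, $m\ge1$, $r_i\ge 1$, set $\sigma_n=1$ if $m=1$ and $\sigma_n=\sum_{i=1}^m r_i$ if $m\ge 2$. *)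

(* Defs.v *)
From mathcomp Require Import all_boot all_fingroup all_solvable.
From mathcomp Require Import boolp.

Set Implicit Arguments.
Unset Strict Implicit.
Unset Printing Implicit Defensive.

(* A finite graph is an adjacency relation [e : rel T] on its vertex type
   [T : finType].  A path from [x] with vertices [x :: p] is given, as in
   path.v, by its first vertex [x] and the sequence [p] of the next ones, so
   that its length is [size p]. *)

Section StrongMetricDimension.

Variables (T : finType) (e : rel T).
Implicit Types (x y z : T) (p q : seq T) (S : {set T}).

Definition shortest_path x y p : Prop :=
  [/\ path e x p, last x p = y
    & forall q, path e x q -> last x q = y -> size p <= size q].

Definition strongly_resolves z x y : Prop :=
     (exists2 p, shortest_path z x p & y \in z :: p)
  \/ (exists2 p, shortest_path z y p & x \in z :: p).

Definition strong_resolving_set S : Prop :=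
  forall x y, x != y -> exists2 z, z \in S & strongly_resolves z x y.

(* The minimum is searched from [setT], which is a strong resolving set as soon
   as the graph is connected; see [sdimP]. *)
Definition sdim : nat :=
  #|[arg min_(S < [set: T] | `[< strong_resolving_set S >]) #|S|]|.

Lemma shortest_path_exists x y :
  connect e x y -> exists p, shortest_path x y p.
Proof.
case/connectP=> p0 ep0 lp0.
have ex: exists n, `[< exists p, [/\ path e x p, last x p = y & size p = n] >].
  by exists (size p0); apply/asboolP; exists p0.
case: (ex_minnP ex) => n /asboolP[p [ep lp sp]] min_n.
exists p; split=> // q eq lq; rewrite sp; apply: min_n.
by apply/asboolP; exists q.
Qed.

Lemma sdimP : (forall x y, connect e x y) ->
  (exists2 S, strong_resolving_set S & #|S| = sdim)
  /\ (forall S, strong_resolving_set S -> sdim <= #|S|).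
Proof.
move=> e_conn; rewrite /sdim; case: arg_minnP => [|S /asboolP resS minS].
  apply/asboolP=> x y _; exists x; rewrite ?inE //; right.
  have [p sp] := shortest_path_exists (e_conn x y).
  by exists p => //; apply: mem_head.
by split=> [|S' resS']; [exists S | apply/minS/asboolP].
Qed.

End StrongMetricDimension.

Section PowerGraph.

Local Open Scope group_scope.
Variable gT : finGroupType.

Definition power_graph : rel gT :=
  fun x y => (x != y) && ((x \in <[y]>) || (y \in <[x]>)).

Lemma power_graphP x y :
  reflect (x <> y /\ ((exists k, x = y ^+ k) \/ (exists k, y = x ^+ k)))
          (power_graph x y).
Proof.
apply: (iffP andP) => [[/eqP nxy /orP pow] | [/eqP nxy pow]]; split=> //.
  by case: pow => /cycleP; [left | right].
by apply/orP; case: pow => /cycleP; [left | right].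
Qed.

Lemma power_graph_connect x y : connect power_graph x y.
Proof.
have sym: connect_sym power_graph.
  by apply: sym_connect_sym => u v; rewrite /power_graph eq_sym orbC.
have to1 u : connect power_graph 1 u.
  have [-> // | u1] := eqVneq u 1.
  by apply: connect1; rewrite /power_graph eq_sym u1 group1.
by apply: connect_trans (to1 y); rewrite sym.
Qed.

End PowerGraph.

(* [primes n] lists the distinct prime divisors of [n], and [logn p n] is the
   exponent of [p] in [n]. *)
Definition sigma (n : nat) : nat :=
  if size (primes n) == 1 then 1 else \sum_(p <- primes n) logn p n.

(* The library's ['D_(2 * n)] is the dihedral group in its standard
   presentation, on the whole of its carrier type. *)
Lemma dihedral_presentation (n : nat) : 1 < n ->
  #|[set: 'D_(2 * n)]| = 2 * n /\
  ([set: 'D_(2 * n)] \isog Grp (a : b : a ^+ n, b ^+ 2, b * a * b = a^-1))%g.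
Proof.
move=> n_gt1; rewrite mul2n; split; first exact: card_dihedral.
move=> rT H; rewrite (Grp_dihedral n_gt1).
apply: eq_existsb => -[a b] /=; rewrite !xpair_eqE.
congr (_ && _); apply: andb_id2l => _; apply: andb_id2l => /eqP b2.
have bV : (b^-1 = b)%g by apply/eqP; rewrite eq_invg_mul; apply/eqP.
by rewrite conjgE bV mulgA.
Qed.

(* Main.v *)
Require Import Defs.
From mathcomp Require Import all_boot all_fingroup all_solvable.

(** A power graph has a vertex, 1, adjacent to all the others, so its shortest
paths have length at most 2.  In such a graph a vertex [z] other than [x] and
[y] strongly resolves [x] and [y] exactly when [x] and [y] are adjacent and [z]
is adjacent to just one of them.  Hence the strong resolving sets are the
complements of the cliques in which no two vertices have the same closed
neighbourhood ([strong_resolving_set_compl]), and [sdim] is the number of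
vertices minus the largest size of such a twin-free clique
([sdim_twin_free_clique]).

In the dihedral group of order [2 * n], every element outside the cyclic group
[<[a]>] of rotations is an involution whose only neighbour is 1, so a clique
that contains one has at most two vertices.  Two rotations are adjacent or equal
exactly when one of their orders divides the other, so a clique of rotations is
a chain of divisors of [n], with elements of the same order being twins.

If [n] is a power of a prime, all the rotations other than 1 are twins, while
any reflection distinguishes 1 from them: the maximum is 2.  If [n] has two
distinct prime divisors, rotations of different orders are never twins
([dvd_comparable_sep]; a reflection is needed to distinguish 1 from a
generator), and the maximum is the length [Omega n + 1] of a maximal chain of
divisors from 1 to [n].  In both cases the maximum is [sigma n + 1].

The argument applies to any finite group that has a nontrivial proper cyclic
subgroup outside which all elements are involutions
([sdim_power_graph_involutions]). *)

(** * Strong resolving sets in a graph with a dominating vertex *)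

Section DominatedGraph.
#[local] Set Implicit Arguments.
#[local] Unset Strict Implicit.

Variables (T : finType) (e : rel T) (u : T).
Hypothesis e_sym : symmetric e.
Hypothesis e_dom : forall x, x != u -> e u x.
Implicit Types (x y z : T) (p : seq T) (C S : {set T}).

Definition closed_nbhd x : pred T := [pred z | (z == x) || e x z].

Definition twin_free_clique C : Prop :=
  {in C &, forall x y, x != y ->
     e x y /\ exists z, closed_nbhd x z != closed_nbhd y z}.

Lemma dominated_connect x y : connect e x y.
Proof.
have to_u z : connect e u z.
  by have [-> //|zu] := eqVneq z u; apply/connect1/e_dom.
by apply: connect_trans (to_u y); rewrite (sym_connect_sym e_sym).
Qed.

Lemma shortest_path_size x y p : shortest_path e x y p -> size p <= 2.
Proof.
case=> _ _ min_p.
have [xu|xu] := eqVneq x u; have [yu|yu] := eqVneq y u.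
- by apply: leq_trans (min_p [::] _ _) _; rewrite ?xu ?yu.
- by apply: leq_trans (min_p [:: y] _ _) _; rewrite //= xu e_dom.
- by apply: leq_trans (min_p [:: u] _ _) _; rewrite //= e_sym e_dom.
by apply: (min_p [:: u; y]); rewrite //= e_sym !e_dom.
Qed.

(** Since [y] is not the starting point [z] nor the end [x], the shortest path
has length 2 and [y] is its middle vertex. *)
Lemma shortest_path_through z x y p :
  shortest_path e z x p -> y \in z :: p -> y != x -> z != y ->
  [/\ e y x, e z y & ~~ e z x].
Proof.
move=> sp yp yx zy; have := shortest_path_size sp.
case: sp yp => ep lp min_p yp szp.
have zx : z != x.
  apply/eqP=> zx; have := min_p [::] isT zx.
  rewrite leqn0 size_eq0 => /eqP p0; move: yp.
  by rewrite p0 inE eq_sym (negPf zy).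
have nzx : ~~ e z x.
  apply/negP=> ezx; have := min_p [:: x].
  rewrite /= ezx => /(_ isT erefl).
  case: p yp lp {ep min_p szp} => [|v [|//]] /=; rewrite !inE eq_sym (negPf zy) //.
  by move=> /eqP yv vx; rewrite yv vx eqxx in yx.
case: p yp ep lp {min_p} szp => [|v [|w [|//]]] /=;
  rewrite !inE eq_sym (negPf zy) //=.
  by move=> /eqP yv _ vx; rewrite yv vx eqxx in yx.
case/orP=> /eqP yv; first by case/and3P=> ezv evw _ wx; rewrite yv -wx evw ezv wx.
by move=> _ wx; rewrite yv wx eqxx in yx.
Qed.

(** A pair that meets [S] is strongly resolved by one of its own members.  For
two vertices [x], [y] outside [S], a path [z, y, x] is a shortest path exactly
when [x] and [y] are adjacent and [z] is in the closed neighbourhood of [y] but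
not of [x].  Such a [z] belongs to [S] for free when the complement is a clique:
it is not adjacent to [x], which lies in that clique. *)
Lemma strong_resolving_set_compl S :
  strong_resolving_set e S <-> twin_free_clique (~: S).
Proof.
split=> [resS x y | cliqS x y xy].
  rewrite !inE => xS yS xy; have [z zS] := resS _ _ xy.
  have zx : z != x by apply: contraNneq xS => <-.
  have zy : z != y by apply: contraNneq yS => <-.
  rewrite eq_sym in xy.
  case=> [[p sp yp] | [p sp xp]].
    have [eyx ezy nzx] := shortest_path_through sp yp xy zy.
    rewrite e_sym; split=> //; exists z.
    rewrite /closed_nbhd /= (negPf zx) (negPf zy) /=.
    by rewrite ![e _ z]e_sym ezy (negPf nzx).
  rewrite eq_sym in xy.
  have [exy ezx nzy] := shortest_path_through sp xp xy zx.
  split=> //; exists z.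
  rewrite /closed_nbhd /= (negPf zx) (negPf zy) /=.
  by rewrite ![e _ z]e_sym ezx (negPf nzy).
have [xS|xS] := boolP (x \in S).
  have [p sp] := shortest_path_exists (dominated_connect x y).
  by exists x => //; right; exists p => //; apply: mem_head.
have [yS|yS] := boolP (y \in S).
  have [p sp] := shortest_path_exists (dominated_connect y x).
  by exists y => //; left; exists p => //; apply: mem_head.
have separated v w z : v \notin S -> e v w -> closed_nbhd w z -> ~~ closed_nbhd v z ->
    z \in S /\ shortest_path e z v [:: w; v].
  move=> vS evw; rewrite /closed_nbhd /= negb_or => wz /andP[zv nvz].
  have zw : z != w by apply: contraNneq nvz => ->.
  rewrite (negPf zw) /= in wz.
  split.
    apply/negPn/negP=> zS; have := cliqS z v.
    rewrite !inE vS zS e_sym => /(_ isT isT zv)[].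
    by rewrite (negPf nvz).
  split=> //=; first by rewrite e_sym wz e_sym evw.
  case=> [|v1 [|//]] /=; first by move=> _ zv1; rewrite zv1 eqxx in zv.
  by rewrite andbT => ezv1 v1v; rewrite -v1v e_sym ezv1 in nvz.
have [||//|exy [z]] := cliqS x y; rewrite ?inE //.
have [zx|zx] := boolP (closed_nbhd x z);
  have [zy|zy] // := boolP (closed_nbhd y z).
  have [] // := separated y x z _ _ zx zy; first by rewrite e_sym.
  move=> zS sp _; exists z => //; right; exists [:: x; y] => //.
  by rewrite !inE eqxx orbT.
have [] // := separated x y z _ _ zy zx.
move=> zS sp _; exists z => //; left; exists [:: y; x] => //.
by rewrite !inE eqxx orbT.
Qed.

Lemma sdim_twin_free_clique C :
  twin_free_clique C -> (forall C', twin_free_clique C' -> #|C'| <= #|C|) ->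
  sdim e = #|T| - #|C|.
Proof.
move=> cliqC maxC; have [[S resS cardS] minS] := sdimP dominated_connect.
apply/eqP; rewrite eqn_leq; apply/andP; split.
  have := minS (~: C); rewrite strong_resolving_set_compl setCK => /(_ cliqC).
  by rewrite -(cardsC C) addKn.
rewrite leq_subLR -cardS -(cardsC S) addnC leq_add2r maxC //.
exact/strong_resolving_set_compl.
Qed.

End DominatedGraph.

(** * Chains of divisors *)

Section DivisorChains.

(** The number of prime factors counted with multiplicity; it equals
[sigma n] unless [n] is [p ^ k] with [p] prime and [1 < k]. *)
Definition Omega (n : nat) : nat := \sum_(p <- primes n) logn p n.

(** Summing over the primes of a common multiple makes [Omega] additive term by
term. *)
Lemma OmegaE N n : 0 < N -> n %| N -> Omega n = \sum_(p <- primes N) logn p n.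
Proof.
move=> N_gt0 nN; have n_gt0 := dvdn_gt0 N_gt0 nN; rewrite /Omega.
have -> : \sum_(p <- primes n) logn p n
    = \sum_(p <- [seq p <- primes N | p \in primes n]) logn p n.
  apply/perm_big/uniq_perm; rewrite ?filter_uniq ?primes_uniq // => p.
  rewrite mem_filter andb_idr // !mem_primes N_gt0 => /and3P[-> _ pn].
  exact: dvdn_trans nN.
rewrite big_filter big_rmcond_in // => p _.
by rewrite -logn_gt0 lt0n negbK => /eqP.
Qed.

Lemma OmegaM m n : 0 < m -> 0 < n -> Omega (m * n) = Omega m + Omega n.
Proof.
move=> m0 n0; have mn0 : 0 < m * n by rewrite muln_gt0 m0.
rewrite (OmegaE _ m mn0) ?dvdn_mulr // (OmegaE _ n mn0) ?dvdn_mull //.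
by rewrite -big_split; apply: eq_bigr => p _; rewrite lognM.
Qed.

Lemma Omega_gt0 n : 1 < n -> 0 < Omega n.
Proof.
move=> n1; have pn : pdiv n \in primes n.
  by rewrite mem_primes pdiv_prime // pdiv_dvd ltnW.
by rewrite /Omega (big_rem _ pn) /= ltn_addr // logn_gt0.
Qed.

Lemma Omega_prime p : prime p -> Omega p = 1.
Proof. by move=> pp; rewrite /Omega primes_prime // big_seq1 logn_prime ?eqxx. Qed.

Lemma leq_Omega d n : 0 < n -> d %| n -> Omega d <= Omega n ?= iff (d == n).
Proof.
move=> n0 /dvdnP[k nE]; move: n0; rewrite {}nE muln_gt0 => /andP[k0 d0].
rewrite OmegaM //; split; first exact: leq_addl.
rewrite -{1}[Omega d]add0n eqn_add2r -{1}[d]mul1n eqn_pmul2r // eq_sym.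
case: k k0 => [//|[|k]] _; first by rewrite /Omega big_nil.
by rewrite gtn_eqF ?Omega_gt0.
Qed.

Definition dvd_comparable d e := (d %| e) || (e %| d).

(** Put [n] on top of a chain for [n / p], where [p] is a prime divisor of [n]. *)
Lemma divisor_chain n : 0 < n ->
  exists s, [/\ uniq s, size s = (Omega n).+1, all (dvdn^~ n) s
                & {in s &, forall d e, dvd_comparable d e}].
Proof.
elim/ltn_ind: n => n IHn n0; have [n1 | n1] := leqP n 1.
  have -> : n = 1 by apply/eqP; rewrite eqn_leq n1.
  exists [:: 1]; split=> //; first by rewrite /Omega big_nil.
  by move=> d e; rewrite !inE => /eqP-> /eqP->.
have [p pp /dvdnP[m mp]] := pdivP n1.
have m0 : 0 < m by move: n0; rewrite mp muln_gt0 => /andP[].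
have mn : m < n by rewrite mp ltn_Pmulr // prime_gt1.
have [s [us sz /allP dvs cs]] := IHn m mn m0.
have dvm d : d \in s -> d %| n by move/dvs=> dm; rewrite mp dvdn_mulr.
exists (n :: s); split.
- rewrite /= us andbT; apply/negP=> /dvs /dvdn_leq => /(_ m0).
  by rewrite leqNgt mn.
- by rewrite /= sz mp (OmegaM _ _ m0 (prime_gt0 pp)) (Omega_prime _ pp) addn1.
- by rewrite /= dvdnn; apply/allP.
move=> d e; rewrite !inE /dvd_comparable.
move=> /predU1P[->|ds] /predU1P[->|es]; rewrite ?dvdnn ?(dvm d) ?(dvm e) ?orbT //.
exact: cs.
Qed.

(** Take [p] a prime with a higher exponent in [d'] than in [d], and [e] the
least power of [p] that does not divide [d]; then [e] divides [d'], and it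
separates [d] and [d'] unless [d] divides [e].  In that case [d] is a power of
[p], and another prime [q] dividing [n] gives a separating divisor: [q] itself
if it divides [d'], and [d * q] otherwise. *)
Lemma dvd_comparable_sep n d d' :
  0 < n -> 1 < size (primes n) -> d %| d' -> d' %| n -> 1 < d -> d != d' ->
  exists2 e, e %| n & dvd_comparable d e != dvd_comparable d' e.
Proof.
move=> n0 n2 dd' d'n d1 nd; have d'0 := dvdn_gt0 n0 d'n.
have d0 : 0 < d by apply: ltnW.
have lt1q : 1 < d' %/ d.
  rewrite ltn_neqAle divn_gt0 // (dvdn_leq d'0 dd') andbT eq_sym.
  by apply: contraNneq nd => q1; rewrite -(divnK dd') q1 mul1n.
set p := pdiv (d' %/ d); have pp : prime p := pdiv_prime lt1q.
set e := p ^ (logn p d).+1.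
have ed' : e %| d'.
  rewrite pfactor_dvdn // -(divnK dd') lognM // ?(ltnW lt1q) //.
  by rewrite -addn1 addnC leq_add2r logn_gt0 mem_primes pp pdiv_dvd ltnW.
have ned : ~~ (e %| d) by rewrite pfactor_dvdn // ltnn.
have [de | nde] := boolP (d %| e); last first.
  exists e; first exact: dvdn_trans d'n.
  by rewrite /dvd_comparable (negPf nde) (negPf ned) ed' orbT.
have pd : p %| d.
  have /(dvdn_pfactor _ _ pp)[[|j] _ dE] := de; first by rewrite dE in d1.
  by rewrite dE dvdn_exp.
have [q qp qn] : exists2 q, q != p & q \in primes n.
  have := primes_uniq n; case: (primes n) n2 => [|q1 [|q2 s]] //= _.
  rewrite inE negb_or => /andP[/andP[q12 _] _].
  have [q1p | q1p] := eqVneq q1 p; last by exists q1; rewrite ?inE ?eqxx.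
  by exists q2; rewrite ?inE ?eqxx ?orbT // -q1p eq_sym.
move: qn; rewrite mem_primes => /and3P[pq _ qn].
have nqd : ~~ (q %| d).
  apply/negP => /dvdn_trans/(_ de); rewrite Euclid_dvdX // andbT.
  by rewrite dvdn_prime2 // (negPf qp).
have [qd' | nqd'] := boolP (q %| d').
  exists q => //; rewrite /dvd_comparable (negPf nqd) qd' !orbT orbF.
  have: ~~ (d %| q); last by move/negPf->.
  by apply: contra qp => /(dvdn_trans pd); rewrite dvdn_prime2 // eq_sym.
exists (d * q).
  by rewrite Gauss_dvd 1?coprime_sym ?prime_coprime // (dvdn_trans dd').
rewrite /dvd_comparable dvdn_mulr //= Gauss_dvdl 1?coprime_sym ?prime_coprime //.
have -> : d' %| d = false.
  by apply: contraNF nd => d'd; rewrite eqn_dvd dd'.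
by rewrite orFb; apply: contra nqd' => /(dvdn_trans (dvdn_mull _ _))->.
Qed.

Lemma dvd_comparable_prime_power n d e :
  0 < n -> size (primes n) == 1 -> d %| n -> e %| n -> dvd_comparable d e.
Proof.
move=> n0 n1; have [p [pp nE]] : exists p, prime p /\ n = p ^ logn p n.
  have := prod_prime_decomp n0; rewrite prime_decompE big_map.
  case: (primes n) n1 (all_prime_primes n) => [//|p [|//]] _ /= /andP[pp _].
  by rewrite big_seq1; exists p.
rewrite nE => /(dvdn_pfactor _ _ pp)[i _ ->] /(dvdn_pfactor _ _ pp)[j _ ->].
rewrite /dvd_comparable.
by case: (leqP i j) => [|/ltnW] ij; rewrite (dvdn_exp2l p ij) ?orbT.
Qed.

End DivisorChains.

(** * The power graph of a group that is cyclic up to involutions *)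

Section CyclicWithInvolutions.
#[local] Set Implicit Arguments.
#[local] Unset Strict Implicit.
Local Open Scope group_scope.

Variables (gT : finGroupType) (a : gT).
Hypothesis a_neq1 : a != 1.
Hypothesis exists_out : exists r, r \notin <[a]>.
Hypothesis out_invol : forall r, r \notin <[a]> -> #[r] = 2.
Implicit Types (x y z r : gT) (C : {set gT}).

Local Notation nbhd := (closed_nbhd (@power_graph gT)).
Local Notation clique := (twin_free_clique (@power_graph gT)).
Local Notation n := #[a].

Lemma nbhdE x z : nbhd x z = (x \in <[z]>) || (z \in <[x]>).
Proof.
rewrite /closed_nbhd /power_graph /= eq_sym.
by have [->|//] := eqVneq x z; rewrite cycle_id.
Qed.

Lemma nbhdC x z : nbhd x z = nbhd z x.
Proof. by rewrite !nbhdE orbC. Qed.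

Lemma nbhd1 z : nbhd 1 z.
Proof. by rewrite nbhdE group1. Qed.

Lemma eq_cycle_nbhd x y : <[x]> = <[y]> -> nbhd x =1 nbhd y.
Proof. by move=> xy z; rewrite !nbhdE xy -!cycle_subG xy. Qed.

(** If [r] is a power of [z], then [z] is outside [<[a]>] too, hence an
involution, so that [z = r]. *)
Lemma nbhd_noncyclic r z : r \notin <[a]> -> nbhd r z = (z == 1) || (z == r).
Proof.
move=> ra; rewrite nbhdE (cycle2g (out_invol ra)) !inE.
apply/idP/idP => [/orP[rz|//]|->]; last by rewrite orbT.
have za : z \notin <[a]>.
  by apply: contra ra => za; apply: (subsetP _ r rz); rewrite cycle_subG.
move: rz; rewrite (cycle2g (out_invol za)) !inE => /predU1P[r1|/eqP->].
  by rewrite r1 group1 in ra.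
by rewrite eqxx orbT.
Qed.

(** A cyclic group has at most one subgroup of each order. *)
Lemma mem_cycle_in x z :
  x \in <[a]> -> z \in <[a]> -> (x \in <[z]>) = (#[x] %| #[z])%N.
Proof.
move=> xa za; rewrite -cycle_subG /order.
by rewrite (cardSg_cyclic (cycle_cyclic a)) ?cycle_subG.
Qed.

Lemma nbhd_cyclic x z :
  x \in <[a]> -> z \in <[a]> -> nbhd x z = dvd_comparable #[x] #[z].
Proof.
by move=> xa za; rewrite nbhdE (mem_cycle_in xa za) (mem_cycle_in za xa).
Qed.

Lemma order_dvd_cyclic x : x \in <[a]> -> (#[x] %| n)%N.
Proof. exact: order_dvdG. Qed.

Lemma order_expg_div d : (d %| n)%N -> #[a ^+ (n %/ d)] = d.
Proof. by move=> dn; rewrite orderXdiv ?dvdn_div // divnA // mulKn. Qed.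

(** An involution outside [<[a]>] is adjacent to 1 but not to [y]. *)
Lemma separate_one y : y \in <[a]> -> y != 1 -> exists z, nbhd 1 z != nbhd y z.
Proof.
move=> ya y1; have [r ra] := exists_out; exists r.
rewrite nbhd1 nbhdC nbhd_noncyclic // (negPf y1) /=.
by have [ry|] := eqVneq y r; rewrite // -ry ya in ra.
Qed.

Lemma separate_cyclic x y : 1 < size (primes n) -> x \in <[a]> -> y \in <[a]> ->
  #[x] %| #[y] -> #[x] != #[y] -> exists z, nbhd x z != nbhd y z.
Proof.
move=> n2 xa ya xy nxy; have [x1 | x1] := eqVneq x 1.
  rewrite x1; apply: separate_one => //.
  by apply: contraNneq nxy => ->; rewrite x1.
rewrite -order_gt1 in x1.
have [e en sep] :=
  dvd_comparable_sep _ _ _ (order_gt0 a) n2 xy (order_dvd_cyclic ya) x1 nxy.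
by exists (a ^+ (n %/ e)); rewrite !nbhd_cyclic ?mem_cycle // order_expg_div.
Qed.

Lemma clique_pair C x y : clique C -> x \in C -> y \in C -> x != y ->
  nbhd x y.
Proof.
by move=> cC xC yC /(cC _ _ xC yC)[exy _]; rewrite /closed_nbhd /= exy orbT.
Qed.

Lemma sigma_order_gt0 : 0 < sigma n.
Proof.
rewrite /sigma; case: ifP => // _; apply: (@Omega_gt0 n).
by rewrite order_gt1.
Qed.

(** Inside [<[a]>], when [#[a]] is not a prime power, the number of prime factors
of the order is injective on a twin-free clique: of two adjacent elements, one
generates a subgroup of the group generated by the other, and equality of the
numbers of prime factors makes these groups equal, hence the elements twins. *)
Lemma twin_free_clique_card C : clique C -> #|C| <= (sigma n).+1.
Proof.
move=> cC; have [/subsetP sCa | /subsetPn[r rC ra]] :=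
  boolP (C \subset <[a]>); last first.
  have /subset_leq_card/leq_trans-> // : C \subset [set 1; r].
    apply/subsetP=> x xC; rewrite !inE -nbhd_noncyclic //.
    have [->|xr] := eqVneq x r; first by rewrite nbhdE cycle_id.
    by rewrite nbhdC (clique_pair cC).
  by rewrite cards2 ltnS (leq_trans (leq_b1 _)) ?sigma_order_gt0.
rewrite /sigma; case: ifP => [n1 | n2].
  (* Any two elements other than 1 are twins: divisors of a prime power are
     comparable, and no involution outside <[a]> is adjacent to either. *)
  rewrite (cardsD1 1) -[2]/(1 + 1)%N leq_add ?leq_b1 //.
  apply/card_le1_eqP=> x y /setD1P[x1 xC] /setD1P[y1 yC].
  apply/esym/eqP/negPn/negP=> /(cC _ _ xC yC)[_ [z]].
  have [xa ya] := (sCa _ xC, sCa _ yC).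
  have [za|za] := boolP (z \in <[a]>).
    have comp := dvd_comparable_prime_power _ _ _ (order_gt0 a) n1.
    by rewrite !nbhd_cyclic // !comp ?order_dvd_cyclic.
  rewrite ![nbhd _ z]nbhdC !nbhd_noncyclic // (negPf x1) (negPf y1) /=.
  have nz t : t \in <[a]> -> t == z = false by apply: contraTF => /eqP->.
  by rewrite !nz.
rewrite -[X in _ <= X]card_ord.
apply: (@leq_card_in _ _ (fun x => inord (Omega #[x]) : 'I_(Omega n).+1)).
move=> x y xC yC /(congr1 val) /=.
have [xa ya] := (sCa _ xC, sCa _ yC).
rewrite !inordK ?ltnS ?leq_Omega ?order_dvd_cyclic // => oxy.
apply/eqP/negPn/negP => xy.
suff cxy : <[x]> = <[y]>.
  by have [_ [z]] := cC _ _ xC yC xy; rewrite (eq_cycle_nbhd cxy) eqxx.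
have := clique_pair cC xC yC xy; rewrite nbhdE -!cycle_subG.
have sub z t : Omega #[z] = Omega #[t] -> <[z]> \subset <[t]> -> <[z]> = <[t]>.
  move=> ozt szt; have [_] := leq_Omega _ #[t] (order_gt0 t) (cardSg szt).
  rewrite -[Omega _]/(Omega #[z]) ozt eqxx => /esym/eqP cardE.
  by apply/eqP; rewrite eqEcard szt; apply: eq_leq (esym cardE).
by case/orP=> [/sub-> // | /sub->].
Qed.

(** For [#[a]] not a prime power, take one element of each order in a maximal
chain of divisors of [#[a]]. *)
Lemma exists_twin_free_clique : exists2 C, clique C & #|C| = (sigma n).+1.
Proof.
(* Comparable orders may be ordered, since separation is symmetric. *)
have sym_clique C : {in C &, forall x y, x != y -> nbhd x y} ->
  {in C &, forall x y, x != y -> #[x] %| #[y] -> exists z, nbhd x z != nbhd y z} ->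
  clique C.
  move=> adjC sepC x y xC yC xy; have nxy := adjC _ _ xC yC xy.
  split; first by move: nxy; rewrite /closed_nbhd /= eq_sym (negPf xy).
  move: nxy; rewrite nbhdE -!cycle_subG => /orP[/cardSg|/cardSg]; first exact: sepC.
  rewrite eq_sym in xy.
  by case/(sepC _ _ yC xC xy)=> z; rewrite eq_sym; exists z.
rewrite /sigma; case: ifP => [_ | n1].
  exists [set 1; a]; last by rewrite cards2 eq_sym a_neq1.
  apply: sym_clique => x y; rewrite !inE.
    by case/pred2P=> ->; case/pred2P=> ->; rewrite ?eqxx ?nbhd1 // nbhdC nbhd1.
  case/pred2P=> ->; case/pred2P=> -> //; rewrite ?eqxx // ?order1.
    by move=> _ _; apply: separate_one; rewrite ?cycle_id.
  by rewrite dvdn1 order_eq1 (negPf a_neq1).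
have n2 : 1 < size (primes n).
  have : primes n != [::] by rewrite primes_eq0 -leqNgt order_gt1.
  by case: (primes n) n1 => [|p [|q s]].
have [s [us ss /allP sn cs]] := divisor_chain _ (order_gt0 a).
have fK : {in s, cancel (fun d => a ^+ (n %/ d)) (fun x => #[x])}.
  by move=> d /sn /order_expg_div.
exists [set x in [seq a ^+ (n %/ d) | d <- s]]; last first.
  rewrite cardsE -[RHS]/(Omega n).+1 -ss -(size_map (fun d => a ^+ (n %/ d))).
  by apply/card_uniqP; rewrite map_inj_in_uniq //; apply: can_in_inj fK.
apply: sym_clique => x y; rewrite !inE => /mapP[d ds ->] /mapP[d' ds' ->].
  by rewrite nbhd_cyclic ?mem_cycle // !fK // cs.
move=> nxy dd'; apply: separate_cyclic => //; rewrite ?mem_cycle // !fK //.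
by apply: contraNneq nxy => ->.
Qed.

Lemma sdim_power_graph_involutions : sdim (@power_graph gT) = #|gT| - (sigma n).+1.
Proof.
have [C cC cardC] := exists_twin_free_clique; rewrite -cardC.
apply: (@sdim_twin_free_clique _ _ 1) cC _ => [x y|x x1|C' cC'].
- by rewrite /power_graph eq_sym orbC.
- by rewrite /power_graph eq_sym x1 group1.
by rewrite cardC twin_free_clique_card.
Qed.

End CyclicWithInvolutions.

(** * The dihedral group *)

Section Dihedral.
Local Open Scope group_scope.

(** Each element outside [<[a]>] is [x * b] with [x] in [<[a]>], and
[(x * b) ^+ 2 = x * x ^ b = 1] because conjugation by [b] inverts [x]. *)
Lemma dihedral_cyclic_half n : 1 < n -> exists a : 'D_(2 * n),
  #[a] = n /\ forall r, r \notin <[a]> -> #[r] = 2.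
Proof.
move=> n1; have [cardD _] := dihedral_presentation n1.
have := Grp_dihedral n1; rewrite -mul2n => /(_ _ [set: 'D_(2 * n)]%G).
rewrite homg_refl => /esym/existsP[[a b] /=].
rewrite !xpair_eqE => /and4P[/eqP defD /eqP an /eqP b2 /eqP ab].
have nab : <[b]> \subset 'N(<[a]>).
  by rewrite cycle_subG; apply/normP; rewrite -cycleJ ab cycleV.
have mulD : <[a]> * <[b]> = [set: 'D_(2 * n)].
  by rewrite -norm_joinEr // -defD.
have oa : #[a] %| n by rewrite order_dvdn an.
have ob : #[b] %| 2 by rewrite order_dvdn b2.
have b_inv : b^-1 = b by apply/eqP; rewrite eq_invg_mul; apply/eqP.
exists a; split.
  (* The product of the orders of a and b is at least the group order 2 n. *)
  apply/eqP; rewrite eqn_leq dvdn_leq ?(ltnW n1) //= -(@leq_pmul2l 2) //.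
  apply: leq_trans (eq_leq (esym cardD)) _; rewrite -mulD.
  have ab_le : #[a] * #[b] <= 2 * #[a] by rewrite mulnC leq_mul2r dvdn_leq ?orbT.
  by apply: leq_trans ab_le; rewrite /order mul_cardG leq_pmulr ?cardG_gt0.
move=> r ra; have: r \in <[a]> * <[b]> by rewrite mulD inE.
case/mulsgP=> x _ /cycleP[i ->] /cycleP[k ->] rE.
have xa := mem_cycle a i.
apply: nt_prime_order => //; last by apply: contraNneq ra => ->; rewrite group1.
move: rE; rewrite -(expg_mod _ b2) modn2; case: (odd k) => rE.
  rewrite rE expg1 expgS expg1 -mulgA -{1}b_inv -[_ * (_ * b)]conjgE.
  by rewrite conjXg ab expgVn mulgV.
by rewrite rE expg0 mulg1 xa in ra.
Qed.

End Dihedral.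

Theorem mainTheorem5 (n : nat) (hn : 3 <= n) :
  sdim (@power_graph 'D_(2 * n)) = 2 * n - (sigma n + 1).
Proof.
have n1 : 1 < n by apply: leq_trans hn.
have [a [oa out]] := dihedral_cyclic_half n n1.
have [cardD _] := dihedral_presentation n1; rewrite cardsT in cardD.
have a_neq1 : (a != 1)%g by rewrite -order_gt1 oa.
have exists_out : exists r, r \notin <[a]>%g.
  apply/existsP; rewrite -negb_forall; apply/negP=> /forallP all_in.
  have: #|'D_(2 * n)| <= #[a]%g.
    by apply/subset_leq_card/subsetP=> x _; apply: all_in.
  by rewrite cardD oa leqNgt ltn_Pmull // ltnW.
have := sdim_power_graph_involutions a_neq1 exists_out out.
by rewrite cardD oa addn1.
Qed.
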